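(* Let $(R, \mathfrak{m})$ be a Cohen--Macaulay (Noetherian) local ring with a canonical module $\omega$. Then $\omega$ is torsionless if and only if $\omega$ is isomorphic, as an $R$-module, to an ideal of $R$.
   Context: Let $k=R/\mathfrak{m}$ and $d=\dim R$. A finitely generated $R$-module $\omega$ is a canonical module of $R$ if $\operatorname{Ext}^i_R(k,\omega)=0$ for $i\neq d$ and $\operatorname{Ext}^d_R(k,\omega)\simeq k$. For an $R$-module $E$, write $E^*=\operatorname{Hom}_R(E,R)$. An $R$-module $E$ is torsionless if the natural homomorphism $E\to E^{**}$ is injective. *)

(* Defs.v *)
From HB Require Import structures.
From mathcomp Require Import all_boot all_algebra.
From mathcomp Require Import generic_quotient ring_quotient.
From mathcomp Require Import boolp.
From mathcomp Require Import finmap monalg.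

Set Implicit Arguments.
Unset Strict Implicit.
Unset Printing Implicit Defensive.

Import GRing.Theory.
Local Open Scope ring_scope.
Local Open Scope quotient_scope.

(* Submodules and ideals are boolean predicates; since boolp makes every
   proposition decidable, this covers all submodules of V and all ideals of R
   (the unit ideal included). *)
Notation ideal R := (submodClosed R^o).

Section Submodule.
Variables (R : comNzRingType) (V : lmodType R) (S : submodClosed V).

Record submod : predArgType := Submod { submod_val : V; _ : submod_val \in S }.

HB.instance Definition _ := [isSub for submod_val].
HB.instance Definition _ := [Choice of submod by <:].
HB.instance Definition _ := [SubChoice_isSubLmodule of submod by <:].
End Submodule.

Section QuotientModule.
Variables (R : comNzRingType) (V : lmodType R) (S : submodClosed V).

Lemma submod_zmod_closed : zmod_closed S.
Proof. exact/GRing.submod_closedB/submodClosedP. Qed.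

Definition submod_zmod : zmodClosed V :=
  HB.pack_for (zmodClosed V) (GRing.SubmodClosed.sort S)
    (GRing.isZmodClosed.Build V (GRing.SubmodClosed.sort S)
       submod_zmod_closed).

Definition quotmod := {ideal_quot submod_zmod}.
HB.instance Definition _ := GRing.Zmodule.on quotmod.
HB.instance Definition _ : EqQuotient V (Quotient.equiv submod_zmod) quotmod :=
  EqQuotient.on quotmod.
HB.instance Definition _ := ZmodQuotient.on quotmod.

Definition qscale (a : R) := lift_op1 quotmod ( *:%R a).

Lemma pi_qscale a : {morph \pi_quotmod : x / a *: x >-> qscale a x}.
Proof.
move=> x; unlock qscale; apply/eqP; rewrite piE /Quotient.equiv -scalerBr.
have: x - repr (\pi_quotmod x) \in submod_zmod by rewrite Quotient.idealrBE reprK.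
by move=> h; exact: (@rpredZ _ _ S).
Qed.
Canonical pi_qscale_morph a := PiMorph1 (pi_qscale a).

Lemma qscaleA a b x : qscale a (qscale b x) = qscale (a * b) x.
Proof. by rewrite -[x]reprK !piE scalerA. Qed.

Lemma qscale1 : left_id 1 qscale.
Proof. by move=> x; rewrite -[x]reprK !piE scale1r. Qed.

Lemma qscaleDr : right_distributive qscale +%R.
Proof. by move=> a x y; rewrite -[x]reprK -[y]reprK !piE scalerDr. Qed.

Lemma qscaleDl x : {morph qscale^~ x : a b / a + b}.
Proof. by move=> a b; rewrite -[x]reprK !piE scalerDl. Qed.

HB.instance Definition _ := GRing.Zmodule_isLmodule.Build R quotmod
  qscaleA qscale1 qscaleDr qscaleDl.
End QuotientModule.

Section HomModule.
Variables (R : comNzRingType) (U V : lmodType R).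
Implicit Types f g h : {linear U -> V}.

Definition Hom := {linear U -> V}.
HB.instance Definition _ := gen_eqMixin Hom.
HB.instance Definition _ := gen_choiceMixin Hom.

Lemma hom_ext f g : f =1 g -> f = g.
Proof.
case: f g => [f [[f1] [f2]]] [g [[g1] [g2]]] /= /funext fg.
case: g / fg g1 g2 => g1 g2.
by rewrite (Prop_irrelevance f1 g1) (Prop_irrelevance f2 g2).
Qed.

Definition hom_zero : Hom := \0.
Definition hom_opp (f : Hom) : Hom := \- f.
Definition hom_add (f g : Hom) : Hom := f \+ g.
Definition hom_scale a (f : Hom) : Hom := a \*: f.

Fact hom_addA : associative hom_add.
Proof. by move=> f g h; apply: hom_ext => x /=; rewrite addrA. Qed.
Fact hom_addC : commutative hom_add.
Proof. by move=> f g; apply: hom_ext => x /=; rewrite addrC. Qed.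
Fact hom_add0 : left_id hom_zero hom_add.
Proof. by move=> f; apply: hom_ext => x /=; rewrite add0r. Qed.
Fact hom_addN : left_inverse hom_zero hom_opp hom_add.
Proof. by move=> f; apply: hom_ext => x /=; rewrite addNr. Qed.
HB.instance Definition _ :=
  GRing.isZmodule.Build Hom hom_addA hom_addC hom_add0 hom_addN.

Fact hom_scaleA a b f : hom_scale a (hom_scale b f) = hom_scale (a * b) f.
Proof. by apply: hom_ext => x /=; rewrite scalerA. Qed.
Fact hom_scale1 : left_id 1 hom_scale.
Proof. by move=> f; apply: hom_ext => x /=; rewrite scale1r. Qed.
Fact hom_scaleDr : right_distributive hom_scale +%R.
Proof. by move=> a f g; apply: hom_ext => x /=; rewrite scalerDr. Qed.
Fact hom_scaleDl f : {morph hom_scale^~ f : a b / a + b}.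
Proof. by move=> a b; apply: hom_ext => x /=; rewrite scalerDl. Qed.
HB.instance Definition _ := GRing.Zmodule_isLmodule.Build R Hom
  hom_scaleA hom_scale1 hom_scaleDr hom_scaleDl.
End HomModule.

Section KernelImage.
Variables (R : comNzRingType) (U V : lmodType R) (f : {linear U -> V}).

Definition mker : {pred U} := [pred x | f x == 0].
Definition mim : {pred V} := [pred y | `[< exists x, f x = y >]].

Fact mker_submod : submod_closed mker.
Proof.
split=> [|a x y]; rewrite !inE ?linear0 // => /eqP fx /eqP fy.
by rewrite linearP fx fy scaler0 addr0.
Qed.
HB.instance Definition _ := GRing.isSubmodClosed.Build R U mker
  (GRing.submod_closed_semi mker_submod).

Fact mim_submod : submod_closed mim.
Proof.
split=> [|a x y]; rewrite !inE; first by apply/asboolP; exists 0; rewrite linear0.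
move=> /asboolP[u <-] /asboolP[v <-]; apply/asboolP.
by exists (a *: u + v); rewrite linearP.
Qed.
HB.instance Definition _ := GRing.isSubmodClosed.Build R V mim
  (GRing.submod_closed_semi mim_submod).
End KernelImage.

(* ker g / (im f :&: ker g), which is ker g / im f when g \o f = 0. *)
Section Homology.
Variables (R : comNzRingType) (A B C : lmodType R).
Variables (f : {linear A -> B}) (g : {linear B -> C}).

Definition boundaries : {pred submod (mker g)} := [pred z | \val z \in mim f].
Fact boundaries_submod : submod_closed boundaries.
Proof.
split=> [|a x y fx fy]; first exact: (rpred0 (mim f)).
change (\val (a *: x + y) \in mim f); rewrite linearP rpredD ?rpredZ //.
Qed.
HB.instance Definition _ := GRing.isSubmodClosed.Build R _ boundaries
  (GRing.submod_closed_semi boundaries_submod).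

Definition homology : lmodType R := quotmod boundaries.
End Homology.

(* The functorial free resolution of M: free_cover M is the free module on the
   underlying set of M, free_eval maps it onto M with kernel first_syzygy M, and
   resolution M i is the free cover of the i-th syzygy module of M. *)
Section FreeResolution.
Variable R : comNzRingType.

Definition free_eval (M : lmodType R) (c : {malg R[M]}) : M :=
  \sum_(x <- msupp c) c@_x *: x.

Fact free_eval_linear (M : lmodType R) : linear (@free_eval M).
Proof.
move=> a c1 c2; pose E := (msupp c1 `|` msupp c2)%fset.
have evalE c : (msupp c `<=` E)%fset -> free_eval c = \sum_(x <- E) c@_x *: x.
  move=> cE; rewrite /free_eval (big_fset_incl _ cE) // => x _ xc.
  by rewrite mcoeff_outdom // scale0r.
rewrite !evalE ?fsubsetUl ?fsubsetUr //; last first.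
  apply: fsubset_trans (msuppD_le _ _) _.
  by rewrite fsetSU // msuppZ_le.
rewrite scaler_sumr -big_split; apply: eq_bigr => x _ /=.
by rewrite mcoeffD mcoeffZ scalerDl scalerA.
Qed.
HB.instance Definition _ (M : lmodType R) :=
  GRing.isLinear.Build R {malg R[M]} M _ (@free_eval M) (@free_eval_linear M).

Definition free_cover (M : lmodType R) : lmodType R := {malg R[M]}.

Definition first_syzygy (M : lmodType R) : lmodType R :=
  submod (mker (@free_eval M)).

Definition free_d (M : lmodType R) :
    {linear free_cover (first_syzygy M) -> free_cover M} :=
  (\val : submod (mker (@free_eval M)) -> _) \o @free_eval (first_syzygy M).

Definition syzygy (M : lmodType R) (i : nat) : lmodType R :=
  iter i first_syzygy M.

Definition resolution (M : lmodType R) (i : nat) : lmodType R :=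
  free_cover (syzygy M i).

Definition resolution_d (M : lmodType R) (i : nat) :
    {linear resolution M i.+1 -> resolution M i} :=
  free_d (syzygy M i).
End FreeResolution.

Section Ext.
Variable R : comNzRingType.

Definition precomp (U V N : lmodType R) (d : {linear U -> V}) :
  Hom V N -> Hom U N := fun f => f \o d.

Fact precomp_linear (U V N : lmodType R) (d : {linear U -> V}) :
  linear (@precomp U V N d).
Proof. by move=> a f g; apply: hom_ext. Qed.
HB.instance Definition _ (U V N : lmodType R) (d : {linear U -> V}) :=
  GRing.isLinear.Build R (Hom V N) (Hom U N) _ (@precomp U V N d)
    (@precomp_linear U V N d).

(* The complex Hom(resolution M, N), whose cohomology is Ext(M, N). *)
Definition Ext_d (M N : lmodType R) (i : nat) :
    {linear Hom (resolution M i) N -> Hom (resolution M i.+1) N} :=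
  @precomp _ _ N (resolution_d M i).

Definition Ext (i : nat) (M N : lmodType R) : lmodType R :=
  if i is j.+1 then homology (Ext_d M N j) (Ext_d M N j.+1)
  else homology (\0 : {linear Hom (resolution M 0) N -> _}) (Ext_d M N 0).

Definition lmod_iso (U V : lmodType R) : Prop :=
  exists f : {linear U -> V}, bijective f.

Definition lmod_trivial (U : lmodType R) : Prop := forall x : U, x = 0.

Definition dualmod (E : lmodType R) : lmodType R := Hom E R^o.

Definition bidual_fun (E : lmodType R) (x : E) (f : dualmod E) : R^o :=
  (f : {linear E -> R^o}) x.
Fact bidual_fun_linear (E : lmodType R) (x : E) : linear (bidual_fun x).
Proof. by []. Qed.
HB.instance Definition _ (E : lmodType R) (x : E) :=
  GRing.isLinear.Build R (dualmod E) R^o _ (bidual_fun x) (bidual_fun_linear x).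

Definition bidual_map (E : lmodType R) (x : E) : dualmod (dualmod E) :=
  bidual_fun x : {linear dualmod E -> R^o}.

Definition torsionless (E : lmodType R) : Prop := injective (@bidual_map E).
End Ext.

Section LocalRings.
Variable R : comNzRingType.
Implicit Types (I m : ideal R) (V : lmodType R).

Definition spanned V (s : seq V) (x : V) : Prop :=
  exists c : nat -> R, x = \sum_(i < size s) c i *: s`_i.

Definition fin_gen V : Prop := exists s : seq V, forall x, spanned s x.

Definition noetherian : Prop := forall I, fin_gen (submod I).

Definition maximal_ideal I : Prop :=
  1 \notin I /\
  forall J : ideal R, {subset I <= J} -> 1 \notin J -> {subset J <= I}.

Definition is_local_ring m : Prop :=
  maximal_ideal m /\ forall I, maximal_ideal I -> I =i m.

Definition prime_ideal I : Prop := 1 \notin I /\ @prime_idealr_closed R I.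

(* Only p 0, ..., p n matter. *)
Definition prime_chain (n : nat) (p : nat -> ideal R) : Prop :=
  (forall i, (i <= n)%N -> prime_ideal (p i)) /\
  (forall i, (i < n)%N ->
     {subset p i <= p i.+1} /\ ~ {subset p i.+1 <= p i}).

Definition has_krull_dim (d : nat) : Prop :=
  (exists p, prime_chain d p) /\
  (forall n p, prime_chain n p -> (n <= d)%N).

Definition regular_sequence (s : seq R^o) : Prop :=
  (forall i x, (i < size s)%N ->
     spanned (take i s) (s`_i * x) -> spanned (take i s) x) /\
  ~ spanned s 1.

Definition has_depth m (d : nat) : Prop :=
  (exists s, [/\ regular_sequence s, {subset s <= m} & size s = d]) /\
  (forall s, regular_sequence s -> {subset s <= m} -> (size s <= d)%N).

Definition cohen_macaulay m : Prop := exists d, has_krull_dim d /\ has_depth m d.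

Definition residue_field m : lmodType R := quotmod m.

Definition canonical_module m (omega : lmodType R) : Prop :=
  fin_gen omega /\
  exists d, [/\ has_krull_dim d,
    forall i, i <> d -> lmod_trivial (Ext i (residue_field m) omega) &
    lmod_iso (Ext d (residue_field m) omega) (residue_field m)].
End LocalRings.

(* Main.v *)
From HB Require Import structures.
Require Import Defs.
From mathcomp Require Import all_boot all_algebra.
From mathcomp Require Import generic_quotient ring_quotient boolp finmap monalg.
From mathcomp Require Import ring zify.

Set Implicit Arguments.
Unset Strict Implicit.
Unset Printing Implicit Defensive.

Import GRing.Theory.
Local Open Scope ring_scope.

(** The converse is immediate: an ideal is separated by its inclusion into [R].
    For the direct implication, let [W] be the canonical module and [d] the
    dimension of [R].

    A linear form [phi] on [W] is injective as soon as, for every associated prime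
    [p] of [W] and some element [y] with annihilator [p], the form does not kill
    [y] after localization at [p]; this uses that the socle of [W] at [p], the
    space of elements killed by [p], is one-dimensional over the residue field of
    [p]. For a single [p] such a form exists because [W] is torsionless
    ([torsionless_good]). There are finitely many associated primes
    ([finite_assoc]), and prime avoidance for modules ([module_avoidance]) yields
    one form that works for all of them ([torsionless_embeds]).

    It remains to see that the socle of [W] at any prime [p] has dimension at most
    one ([ext_socle_le1]). This goes by induction on the dimension of [R / p],
    for a finitely generated module [M] with [Ext i k M = 0] for [i < d] and
    [Ext d k M] at most one-dimensional. If [d = 0] then [p] is the maximal ideal
    and [Ext 0 k M] is the socle in question. If [d > 0], the maximal ideal is
    not associated to [M] and so contains an [M]-regular element [x]. The long
    exact sequence of Ext passes the hypotheses on to [M / x M], with [d]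
    lowered by one ([ext_zero_quot], [ext_le1_quot]).

    The key step [socle_descent] compares lengths. Let [N] be the part of [M]
    killed by [p], let [q] be a minimal prime over [p + x R], and let [b] be the
    length of [R / (p + x R)] at [q]. As [M / x M] has a socle of dimension at
    most one at [q], a filtration of [R / (p + x R)] with factors [R / p'] for
    primes [p'] bounds the length of [N / x N] at [q] by [b] ([qlen_killed]), and
    so that of [N / x ^ n N] by [n * b]. If [N] contained a free [R / p]-module
    of rank two, the length of [N / x ^ n N] would be at least
    [2 * n * b] up to a bounded error, a contradiction.

    Lengths at [q] are measured without localizing: [qindep] describes sequences
    of elements whose successive spans have distinct localizations at [q]. *)

(** * Submodules, primes and finite generation *)

Section Submodules.
Variable R : comNzRingType.
Implicit Types (V W : lmodType R).

Record issub V (S : V -> Prop) : Prop := IsSub {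
  issub0 : S 0;
  issubD : forall x y, S x -> S y -> S (x + y);
  issubZ : forall a x, S x -> S (a *: x) }.

Lemma issubN V (S : V -> Prop) x : issub S -> S x -> S (- x).
Proof. by move=> HS Sx; rewrite -scaleN1r; apply: issubZ. Qed.

Lemma issubB V (S : V -> Prop) x y : issub S -> S x -> S y -> S (x - y).
Proof. by move=> HS Sx Sy; apply: issubD => //; apply: issubN. Qed.

Lemma issubBr V (S : V -> Prop) x y : issub S -> S y -> S (x - y) -> S x.
Proof. by move=> HS Sy Sxy; rewrite -(subrK y x); apply: issubD. Qed.

Lemma issubI V (S T : V -> Prop) : issub S -> issub T -> issub (fun z => S z /\ T z).
Proof.
move=> HS HT; split=> [|x y [Sx Tx] [Sy Ty]|a x [Sx Tx]]; split;
  by [exact: issub0|exact: issubD|exact: issubZ].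
Qed.

Lemma issub_mem V (S : submodClosed V) : issub (fun x => x \in S).
Proof. by split=> [|x y|a x]; [exact: rpred0|exact: rpredD|exact: rpredZ]. Qed.

Definition adjoin V (S : V -> Prop) (w z : V) : Prop := exists a : R, S (z - a *: w).

Lemma adjoin_sub V (S : V -> Prop) w : issub S -> issub (adjoin S w).
Proof.
move=> HS; split=> [|x y [a Sx] [b Sy]|c x [a Sx]].
- by exists 0; rewrite scale0r subr0; apply: issub0.
- exists (a + b); rewrite scalerDl opprD addrACA; exact: issubD.
- by exists (c * a); rewrite -scalerA -scalerBr; apply: issubZ.
Qed.

Lemma adjoin_in V (S : V -> Prop) w z : S z -> adjoin S w z.
Proof. by move=> Sz; exists 0; rewrite scale0r subr0. Qed.

Lemma adjoin_gen V (S : V -> Prop) w : issub S -> adjoin S w w.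
Proof. by move=> HS; exists 1; rewrite scale1r subrr; apply: issub0. Qed.

Lemma adjoin_le V (S T : V -> Prop) w : issub T ->
  (forall z, S z -> T z) -> T w -> forall z, adjoin S w z -> T z.
Proof.
by move=> HT ST Tw z [a Sz]; apply: (issubBr HT) (ST _ Sz); apply: issubZ.
Qed.

Fixpoint spn V (s : seq V) : V -> Prop :=
  if s is w :: s' then adjoin (spn s') w else fun z => z = 0.

Lemma spn_sub V (s : seq V) : issub (spn s).
Proof.
elim: s => [|w s IH] /=; last exact: adjoin_sub.
by split=> [//|x y -> ->|a x ->]; rewrite ?addr0 ?scaler0.
Qed.

Lemma spn_mem V (s : seq V) z : z \in s -> spn s z.
Proof.
elim: s => [//|w s IH]; rewrite inE => /predU1P[->|/IH]; last exact: adjoin_in.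
exact: adjoin_gen (spn_sub s).
Qed.

Lemma spn_le V (s : seq V) (S : V -> Prop) : issub S ->
  (forall z, z \in s -> S z) -> forall z, spn s z -> S z.
Proof.
move=> HS; elim: s => [_ z -> /=|w s IH sS]; first exact: issub0.
apply: adjoin_le => // [|]; last by apply: sS; rewrite mem_head.
by apply: IH => z zs; apply: sS; rewrite inE zs orbT.
Qed.

Lemma spanned_spn V (s : seq V) x : spanned s x -> spn s x.
Proof.
case=> c ->.
elim/big_ind: _ => [|y z|i _]; first exact: issub0 (spn_sub s).
  exact: issubD (spn_sub s) _ _.
by apply: (issubZ (spn_sub s)); apply: spn_mem; rewrite mem_nth.
Qed.

Lemma spn_spanned V (s : seq V) x : spn s x -> spanned s x.
Proof.
elim: s x => [x /= ->|w s IH x [a /IH[c xE]]].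
  by exists (fun=> 0); rewrite big_ord0.
exists (fun i => if i is j.+1 then c j else a).
by rewrite big_ord_recl /= -xE addrC subrK.
Qed.

Lemma spn_map V W (f : {linear V -> W}) (s : seq V) x :
  spn s x -> spn (map f s) (f x).
Proof.
elim: s x => [x /= ->|w s IH x [a /IH sx]]; first exact: linear0.
by exists a; rewrite -linearZ -linearB.
Qed.

Definition annih V (y : V) (a : R^o) : Prop := a *: y = 0.

Record isprime (P : R^o -> Prop) : Prop := IsPrime {
  prime_sub : issub P;
  prime1 : ~ P 1;
  primeM : forall a b : R, P (a * b) -> P a \/ P b }.

Lemma ideal_mull (P : R^o -> Prop) (a b : R) : issub P -> P b -> P (a * b).
Proof. by move=> HP Pb; exact: (issubZ HP a Pb). Qed.

Lemma ideal_mulr (P : R^o -> Prop) (a b : R) : issub P -> P b -> P (b * a).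
Proof. by move=> HP Pb; rewrite mulrC; apply: ideal_mull. Qed.

Lemma primeMn P (a b : R) : isprime P -> ~ P a -> ~ P b -> ~ P (a * b).
Proof. by move=> HP Pa Pb /(primeM HP)[]. Qed.

Lemma colon_sub V (S : V -> Prop) y : issub S -> issub (fun a : R^o => S (a *: y)).
Proof.
move=> HS; split=> [|a b Sa Sb|a b Sb]; first by rewrite scale0r; apply: issub0.
  by rewrite scalerDl; apply: issubD.
by rewrite -scalerA; apply: issubZ.
Qed.

Lemma zero_sub V : issub (fun z : V => z = 0).
Proof. exact: (spn_sub [::]). Qed.

Lemma annih_sub V (y : V) : issub (annih y).
Proof. exact: (colon_sub y (zero_sub V)). Qed.

Lemma annih0 (V : lmodType R) (y : V) : isprime (annih y) -> y <> 0.
Proof. by move=> Py y0; apply: (prime1 Py); rewrite /annih scale1r. Qed.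

End Submodules.

(** * Maximal conditions *)

Section Noetherian.
Variable R : comNzRingType.
Hypothesis noethR : noetherian R.
Implicit Types (V : lmodType R).

Definition mksub V (S : V -> Prop) : {pred V} := [pred z | `[< S z >]].

Lemma mksub_closed V (S : V -> Prop) : issub S -> GRing.submod_closed (mksub S).
Proof.
move=> HS; split=> [|a x y]; rewrite !inE; first by apply/asboolP; apply: issub0.
move=> /asboolP Sx /asboolP Sy; apply/asboolP; apply: issubD => //.
exact: issubZ.
Qed.

Definition subOf V (S : V -> Prop) (HS : issub S) : submodClosed V :=
  HB.pack_for (submodClosed V) (mksub S)
    (GRing.isSubmodClosed.Build R V (mksub S)
       (GRing.submod_closed_semi (mksub_closed HS))).

Lemma subOfP V (S : V -> Prop) (HS : issub S) z : reflect (S z) (z \in subOf HS).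
Proof. exact: asboolP. Qed.

Lemma ideal_fg (I : R^o -> Prop) : issub I ->
  exists s : seq R^o, (forall a, a \in s -> I a) /\ forall a, I a -> spn s a.
Proof.
move=> HI; have [s sP] := noethR (subOf HI).
exists (map (@submod_val _ _ _) s); split=> [a /mapP[[b bI] _ ->]|a Ia] /=.
  exact/subOfP.
have aI : a \in subOf HI by apply/subOfP.
have /spanned_spn/(spn_map (\val : {linear submod (subOf HI) -> R^o})) := sP (Submod aI).
exact.
Qed.

(** Induction on a generating list: the leading coefficients of the elements of
    a submodule along the first generator form an ideal of [R]. *)
Lemma sub_spn_fg V (s : seq V) (S : V -> Prop) : issub S ->
  (forall z, S z -> spn s z) ->
  exists t : seq V, (forall z, z \in t -> S z) /\ forall z, S z -> spn t z.
Proof.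
elim: s S => [|w s IH] S HS Ss; first by exists [::].
pose I (a : R^o) := exists2 z, S z & spn s (z - a *: w).
have HI : issub I.
  split=> [|a b [x Sx sx] [y Sy sy]|c a [x Sx sx]].
  - by exists 0; [exact: issub0|rewrite scale0r subr0; exact: issub0 (spn_sub s)].
  - exists (x + y); first exact: issubD.
    by rewrite scalerDl opprD addrACA; apply: issubD (spn_sub s) _ _ _ _.
  - exists (c *: x); first exact: issubZ.
    by rewrite -scalerA -scalerBr; apply: (issubZ (spn_sub s)).
have [la [lI Il]] := ideal_fg HI.
have [t1 [t1S t1P]] : exists t1 : seq V, (forall z, z \in t1 -> S z) /\
    forall a, spn la a -> exists2 z, spn t1 z & spn s (z - a *: w).
  elim: la lI {Il} => [_|b la IHl lI].
    exists [::]; split=> // a -> /=; exists 0 => //.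
    by rewrite scale0r subr0; exact: issub0 (spn_sub s).
  have [t1 [t1S t1P]] := IHl (fun a ala => lI a (mem_behead (s := b :: la) ala)).
  have [z Sz sz] := lI b (mem_head _ _).
  exists (z :: t1); split=> [u|a /= [c /t1P[u tu su]]].
    by rewrite inE => /predU1P[->|/t1S].
  exists (c *: z + u); first by exists c; rewrite addrAC subrr add0r.
  have -> : c *: z + u - a *: w = c *: (z - b *: w) + (u - (a - c *: b) *: w).
    rewrite scalerBr scalerBl scalerA; rewrite [c *: b]/GRing.scale /=.
    by rewrite opprB addrACA addKr.
  by apply: issubD (spn_sub s) _ _ _ su; apply: (issubZ (spn_sub s)).
have [t2 [t2S t2P]] := IH (fun z => S z /\ spn s z)
  (issubI HS (spn_sub s))
  (fun z (Sz : S z /\ spn s z) => Sz.2).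
exists (t1 ++ t2); split=> [z|z Sz].
  by rewrite mem_cat => /orP[/t1S|/t2S[]].
have [a sa] := Ss _ Sz.
have [|u t1u su] := t1P a; first by apply: Il; exists z.
have HT := spn_sub (t1 ++ t2).
have Su : S u by apply: (spn_le HS t1S).
rewrite -(subrK u z); apply: issubD => //.
  apply: (spn_le HT _ (t2P (z - u) _)) => [v vt2|].
    by apply: spn_mem; rewrite mem_cat vt2 orbT.
  split; first exact: issubB.
  have -> : z - u = (z - a *: w) - (u - a *: w) by rewrite opprB addrA subrK.
  exact: issubB (spn_sub s) _ _.
by apply: (spn_le HT _ t1u) => v vt1; apply: spn_mem; rewrite mem_cat vt1.
Qed.

Lemma fg_sub V (S : V -> Prop) : fin_gen V -> issub S ->
  exists t : seq V, (forall z, z \in t -> S z) /\ forall z, S z -> spn t z.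
Proof. by case=> s sP HS; apply: (sub_spn_fg (s := s)) => // z _; exact/spanned_spn/sP. Qed.

(** A strictly increasing sequence of members of [P] would have a finitely
    generated union, hence would be stationary. *)
Lemma fg_max V (P : (V -> Prop) -> Prop) (S0 : V -> Prop) : fin_gen V ->
  (forall S, P S -> issub S) -> P S0 ->
  exists2 S, P S & forall T, P T -> (forall z, S z -> T z) -> forall z, T z -> S z.
Proof.
move=> fgV Psub PS0; apply: contrapT => nomax.
have step (A : {S | P S}) : exists B : {S | P S},
    (forall z, sval A z -> sval B z) /\ ~ (forall z, sval B z -> sval A z).
  case: A => S PS /=; apply: contrapT => noB; apply: nomax; exists S => // T PT ST.
  by apply: contrapT => nTS; apply: noB; exists (exist _ T PT).
have [next nextP] := choice step.
pose A n := sval (iter n next (exist _ S0 PS0)).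
have AS n z : A n z -> A n.+1 z by case: (nextP (iter n next (exist _ S0 PS0))) => + _; apply.
have Amono n k z : A n z -> A (k + n)%N z.
  by move=> An; elim: k => // k IH; apply: AS.
have Asub n : issub (A n) by apply: Psub; apply: svalP.
have HU : issub (fun z => exists n, A n z).
  split=> [|x y [n Ax] [k Ay]|a x [n Ax]]; first by exists 0%N; apply: issub0.
    exists (n + k)%N; apply: (issubD (Asub _)); last exact: Amono.
    by rewrite addnC; apply: Amono.
  by exists n; apply: (issubZ (Asub n)).
have [t [tU Ut]] := fg_sub fgV HU.
have [n tn] : exists n, forall z, z \in t -> A n z.
  elim: t tU {Ut} => [|w t IH] tU; first by exists 0%N.
  have [n tn] := IH (fun a ala => tU a (mem_behead (s := w :: t) ala)).
  have [k wk] := tU w (mem_head _ _).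
  exists (n + k)%N => z; rewrite inE => /predU1P[->|/tn]; first exact: Amono.
  by rewrite addnC; apply: Amono.
case: (nextP (iter n next (exist _ S0 PS0))) => _; apply => z Az.
by apply: (spn_le (Asub n) tn); apply: Ut; exists n.+1.
Qed.

Lemma regular_fg : fin_gen R^o.
Proof.
exists [:: 1] => a; apply: spn_spanned; exists a => /=.
by rewrite -[a *: 1]/(a * 1) mulr1 subrr.
Qed.

(** An ideal that is maximal among the annihilators of the nonzero multiples of
    [z0] modulo [S] is prime. *)
Lemma assoc_prime V (S : V -> Prop) z0 : issub S -> ~ S z0 ->
  exists r : R, isprime (fun a : R^o => S (a *: (r *: z0))).
Proof.
move=> HS nz0.
pose P (I : R^o -> Prop) := exists2 r : R, ~ S (r *: z0) & I = fun a => S (a *: (r *: z0)).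
have [||I [r nr ->] Imax] := fg_max (P := P) (S0 := fun a : R^o => S (a *: z0)) regular_fg.
- by move=> I [r _ ->]; apply: colon_sub.
- by exists 1; rewrite ?scale1r.
exists r; split=> [||a b Sab]; first exact: colon_sub.
  by rewrite scale1r.
have [Sb|nb] := EM (S (b *: (r *: z0))); [by right|left].
apply: (Imax (fun c : R^o => S (c *: ((b * r) *: z0)))) => [|c Sc|].
- by exists (b * r); rewrite -?scalerA.
- by move: (issubZ HS b Sc); rewrite !scalerA mulrCA mulrA.
- by move: Sab; rewrite !scalerA mulrA.
Qed.

Lemma ideal_ind (P : (R^o -> Prop) -> Prop) :
  (forall I, issub I ->
    (forall J, issub J -> (forall a, I a -> J a) -> ~ (forall a, J a -> I a) -> P J) ->
    P I) ->
  forall I, issub I -> P I.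
Proof.
move=> Pind I HI; apply: contrapT => nPI.
have [||J [HJ nPJ] Jmax] := fg_max (P := fun J => issub J /\ ~ P J) (S0 := I) regular_fg.
- by move=> ? [].
- by [].
apply: nPJ; apply: Pind => // K HK JK nKJ; apply: contrapT => nPK.
exact/nKJ/Jmax.
Qed.

End Noetherian.

(** * Finite families of primes *)

Section PrimeFamilies.
Variable R : comNzRingType.
Implicit Types (V : lmodType R) (p q : R^o -> Prop).

Lemma list_minimal (T : eqType) (le : T -> T -> Prop) (s : seq T) :
  (forall x y z, le x y -> le y z -> le x z) -> s <> [::] ->
  exists2 x, x \in s & forall y, y \in s -> le y x -> le x y.
Proof.
move=> tr; elim: s => [//|a [|b s] IH] _.
  by exists a => [|y]; rewrite inE // => /eqP ->.
have [//|x xs xmin] := IH.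
have [ax|nax] := EM (le a x).
  exists a => [|y]; first exact: mem_head.
  rewrite inE => /predU1P[->//|ys ya].
  exact: tr ax (xmin _ ys (tr _ _ _ ya ax)).
exists x => [|y]; first by rewrite inE xs orbT.
by rewrite inE => /predU1P[->//|]; apply: xmin.
Qed.

Lemma prime_outside (T : eqType) (p : T -> R^o -> Prop) q (s : seq T) :
  (forall j, j \in s -> issub (p j)) -> isprime q ->
  (forall j, j \in s -> exists2 c : R, p j c & ~ q c) ->
  exists2 c : R, forall j, j \in s -> p j c & ~ q c.
Proof.
move=> ps Pq; elim: s ps => [|i s IH] ps sP.
  by exists 1 => //; apply: prime1 Pq.
have ms j : j \in s -> j \in i :: s by rewrite inE orbC => ->.
have [j js|j js|c cP qc] := IH; [exact/ps/ms|exact/sP/ms|].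
have [a pa qa] := sP i (mem_head _ _).
exists (a * c); last exact: primeMn.
move=> j; rewrite inE => /predU1P[->|js].
  by apply: ideal_mulr => //; apply: ps; apply: mem_head.
by apply: ideal_mull (cP j js); apply/ps/ms.
Qed.

(** Prime avoidance for modules: [bad i] behaves like the kernel of a map from
    [V] to a torsion-free module over [R / p i]. A vector escaping the bad
    submodules of all primes but a minimal one is corrected by [c *: w], where
    [c] lies in the other primes, so that their conditions are not disturbed. *)
Lemma module_avoidance V (T : eqType) (s : seq T) (p : T -> R^o -> Prop)
    (bad : T -> V -> Prop) :
  (forall i, i \in s -> isprime (p i)) ->
  (forall i, i \in s -> issub (bad i)) ->
  (forall i (c : R) v, i \in s -> p i c -> bad i (c *: v)) ->
  (forall i (c : R) v, i \in s -> ~ p i c -> bad i (c *: v) -> bad i v) ->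
  (forall i j, i \in s -> j \in s -> (forall c, p i c -> p j c) ->
     (forall c, p j c -> p i c) -> forall v, bad i v -> bad j v) ->
  (forall i, i \in s -> exists v, ~ bad i v) ->
  exists v, forall i, i \in s -> ~ bad i v.
Proof.
elim: {s}_.+1 {-2}s (ltnSn (size s)) => // n IH s.
rewrite ltnS => sz pP bP bp bnp bb bex.
have [->|s0] := eqVneq s [::]; first by exists 0.
have [|i si imin] := list_minimal (le := fun i j => forall c, p i c -> p j c) (s := s) _ (elimN eqP s0).
  by move=> x y z xy yz c /xy /yz.
pose s' := [seq j <- s | j != i].
have ms j : j \in s' -> j \in s by rewrite mem_filter => /andP[].
have [|||||||v vP] := IH s'.
- rewrite size_filter (leq_trans _ sz) // -(count_predC (pred1 i)) -add1n leq_add2r.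
  by rewrite -has_count has_pred1.
- by move=> j /ms; apply: pP.
- by move=> j /ms; apply: bP.
- by move=> j c u /ms; apply: bp.
- by move=> j c u /ms; apply: bnp.
- by move=> j k /ms js /ms ks; apply: bb.
- by move=> j /ms; apply: bex.
have [bv|nbv] := EM (bad i v); last first.
  exists v => j js; have [->//|ji] := eqVneq j i.
  by apply: vP; rewrite mem_filter ji.
have [w nw] := bex i si.
have [j /ms js|j js'|c cP pic] := prime_outside (p := p) (s := s') _ (pP i si).
- exact: prime_sub (pP j js).
- apply: contrapT => nc; have js := ms _ js'.
  have ji c : p j c -> p i c by move=> pc; apply: contrapT => nic; apply: nc; exists c.
  by apply: (vP j js'); apply: bb bv => //; apply: imin.
exists (v + c *: w) => j js; have [->|ji] := eqVneq j i => bvw.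
  apply: nw; apply: (bnp i c w) => //.
  by rewrite -(addKr v (c *: w)) addrC; apply: issubB (bP i si) _ _.
have js' : j \in s' by rewrite mem_filter ji.
apply: (vP j js'); rewrite -(addrK (c *: w) v); apply: issubB (bP j js) bvw _.
exact: bp (cP j js').
Qed.

Hypothesis noethR : noetherian R.

(** If [S] contains no nonzero multiple of [y], then the span
    of [y] embeds into that of [z] modulo [S], a copy of [R] modulo a prime, all
    of whose nonzero elements have the same annihilator. *)
Lemma prime_extend V (S : V -> Prop) z (y : V) : issub S ->
  isprime (fun a : R^o => S (a *: z)) -> isprime (annih y) -> adjoin S z y ->
  (exists2 a : R, ~ annih y a & S (a *: y)) \/
  (forall a, annih y a <-> S (a *: z)).
Proof.
move=> HS Pz Py [r Syr].
have [[a ya Sa]|nS] := EM (exists2 a : R, ~ annih y a & S (a *: y)); [by left; exists a|right].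
have nr : ~ S (r *: z).
  move=> Srz; apply: nS; exists 1; first exact: prime1 Py.
  by rewrite scale1r; apply: issubBr Syr.
move=> a; split=> [ya|Sa].
  have : S ((a * r) *: z).
    rewrite -scalerA -[_ *: _]opprK; apply: (issubN HS).
    by have := issubZ HS a Syr; rewrite scalerBr (ya : _ = 0) sub0r.
  by case/(primeM Pz (a := a) (b := r)).
apply: contrapT => ya; apply: nS; exists a => //; have Sa1 := issubZ HS a Syr.
have -> : a *: y = a *: (y - r *: z) + r *: (a *: z).
  by rewrite scalerBr !scalerA [r * a]mulrC subrK.
by apply: (issubD HS Sa1); apply: (issubZ HS).
Qed.

(** A submodule that is maximal among those whose elements satisfy the conclusion
    is the whole module: adjoining an element with prime colon ideal contributes
    at most this prime. *)
Lemma finite_assoc V : fin_gen V ->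
  exists s : seq V, (forall y : V, y \in s -> isprime (annih y)) /\
    forall y : V, isprime (annih y) ->
      exists2 y', y' \in s & forall a, annih y a <-> annih y' a.
Proof.
move=> fgV.
pose P (S : V -> Prop) := issub S /\
  exists s : seq V, (forall y : V, y \in s -> isprime (annih y)) /\
    forall y : V, S y -> isprime (annih y) ->
      exists2 y', y' \in s & forall a, annih y a <-> annih y' a.
have [||S [HS [s [sP Ss]]] Smax] := fg_max noethR (P := P) (S0 := fun z => z = 0) fgV.
- by move=> S [].
- split; first exact: zero_sub.
  by exists [::]; split=> // y -> /annih0.
exists s; split=> // y; apply: (Ss); apply: contrapT => nSy.
have [r Pz] := assoc_prime noethR HS nSy; set z := r *: y in Pz.
have nSz : ~ S z by move=> Sz; apply: (prime1 Pz); rewrite scale1r.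
apply: nSz; apply: (Smax (adjoin S z)) => [|w|]; first 1 last.
- exact: adjoin_in.
- exact: adjoin_gen.
split; first exact: adjoin_sub.
(* One more prime suffices: an element of [adjoin S z] whose annihilator is prime
   either has a multiple in [S] with the same annihilator or has annihilator
   equal to the colon ideal of [z]. *)
have old (u : V) (a : R) : isprime (annih u) -> ~ annih u a -> S (a *: u) ->
    exists2 y', y' \in s & forall c, annih u c <-> annih y' c.
  move=> Pu ua Sau.
  have uau c : annih u c <-> annih (a *: u) c.
    rewrite /annih scalerA; split=> [uc|].
      by rewrite mulrC -scalerA uc scaler0.
    by move/(primeM Pu) => [].
  have [|y' y's y'P] := Ss _ Sau.
    split; first exact: annih_sub.
      by move/(uau 1); apply: prime1 Pu.
    by move=> c d /uau /(primeM Pu)[/uau|/uau]; [left|right].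
  by exists y' => // c; rewrite uau.
have [[y0 [Sy0 Py0 y0z]]|none] := EM (exists y0,
    [/\ adjoin S z y0, isprime (annih y0) & forall a, annih y0 a <-> S (a *: z)]).
  exists (y0 :: s); split=> [u|u Su Pu].
    by rewrite inE => /predU1P[->|/sP].
  have [[a ua Sa]|uz] := prime_extend HS Pz Pu Su.
    by have [y' y's y'P] := old u a Pu ua Sa; exists y'; rewrite // inE y's orbT.
  by exists y0; [exact: mem_head|move=> a; rewrite uz y0z].
exists s; split=> // u Su Pu.
have [[a ua Sa]|uz] := prime_extend HS Pz Pu Su; first exact: old ua Sa.
by case: none; exists u.
Qed.

Definition prime_over (I : R^o -> Prop) p := isprime p /\ forall a, I a -> p a.

(** If [I] contains [a * b] but neither factor, every prime over [I] lies over
    [I + a R] or over [I + b R], to which noetherian induction applies. *)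
Lemma finite_primes_over (I : R^o -> Prop) : issub I ->
  exists s : seq (R^o -> Prop), (forall p, p \in s -> prime_over I p) /\
    forall p, prime_over I p -> exists2 p', p' \in s & forall a, p' a -> p a.
Proof.
move: I; apply: (ideal_ind noethR) => I HI IH.
have [I1|nI1] := EM (I 1).
  by exists [::]; split=> // p [Pp Ip]; case: (prime1 Pp); apply: Ip.
have [Pr|nPr] := EM (isprime I).
  exists [:: I]; split=> [p|p [_ Ip]]; first by rewrite inE => /eqP ->.
  by exists I; rewrite // mem_head.
have [a [b [Iab na nb]]] : exists a b : R, [/\ I (a * b), ~ I a & ~ I b].
  apply: contrapT => nab; apply: nPr; split=> // a b Iab; apply: contrapT => nIab.
  by apply: nab; exists a, b; split=> // H; apply: nIab; [left|right].
have sub c : ~ I c -> exists s : seq (R^o -> Prop),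
    (forall p, p \in s -> prime_over I p) /\ forall p, prime_over I p -> p c ->
      exists2 p', p' \in s & forall a, p' a -> p a.
  move=> nc; have [|d|H|s [sI sP]] := IH (adjoin I c).
  - exact: adjoin_sub.
  - exact: adjoin_in.
  - by apply/nc/H/adjoin_gen.
  exists s; split=> [p /sI [Pp Ip]|p [Pp Ip] pc].
    by split=> // d Id; apply/Ip/adjoin_in.
  by apply: sP; split=> // d; apply: adjoin_le => //; apply: prime_sub.
have [sa [saI saP]] := sub a na; have [sb [sbI sbP]] := sub b nb.
exists (sa ++ sb); split=> [p|p Ip].
  by rewrite mem_cat => /orP[/saI|/sbI].
have [Pp /(_ _ Iab) /(primeM Pp)[pa|pb]] := Ip.
  by have [p' p's] := saP p Ip pa; exists p'; rewrite // mem_cat p's.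
by have [p' p's] := sbP p Ip pb; exists p'; rewrite // mem_cat p's orbT.
Qed.

Lemma minimal_prime (I : R^o -> Prop) : issub I -> ~ I 1 ->
  exists2 q, prime_over I q &
    forall p, prime_over I p -> (forall a, p a -> q a) -> forall a, q a -> p a.
Proof.
move=> HI nI; have [s [sI sP]] := finite_primes_over HI.
have [p0 Ip0] : exists p0, prime_over I p0.
  have [r Pr] := assoc_prime noethR (z0 := (1 : R^o)) HI nI.
  by eexists; split; first exact: Pr; move=> a Ia /=; apply: ideal_mulr.
have s0 : s <> [::] by move=> s0; have [p] := sP _ Ip0; rewrite s0.
have [x y z xy yz a /xy /yz //|q qs qmin] :=
  list_minimal (le := fun p p' : R^o -> Prop => forall a, p a -> p' a) _ s0.
exists q; first exact: sI.
move=> p Ip pq a qa; have [p' p's p'p] := sP p Ip.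
by apply: (p'p); apply: (qmin p' p's) => // b /p'p /pq.
Qed.
End PrimeFamilies.

(** * Length at a prime *)

Section LocalLength.
Variable R : comNzRingType.
Implicit Types (V W : lmodType R).
Variable q : R^o -> Prop.
Hypothesis Pq : isprime q.

(** Each term [w] of the sequence gives a strict inclusion of the submodules
    generated so far after localization at [q]: the colon ideal of [w] lies in
    [q]. The maximal size of such a sequence in [T] is thus the length of
    [T / S] localized at [q]. *)
Fixpoint qindep V (S : V -> Prop) (s : seq V) : Prop :=
  if s is w :: s' then (forall a : R, S (a *: w) -> q a) /\ qindep (adjoin S w) s'
  else True.

Lemma qindep_restr V (F S S' : V -> Prop) s : issub F ->
  (forall z, z \in s -> F z) -> (forall z, F z -> S' z -> S z) ->
  qindep S s -> qindep S' s.
Proof.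
move=> HF; elim: s S S' => [//|w s IH] S S' Fs SS' /= [Sw Ss].
have Fw : F w by apply: Fs; rewrite mem_head.
split=> [a S'a|]; first by apply/Sw/SS' => //; apply: issubZ.
apply: IH Ss => [z zs|z Fz [a S'a]]; first by apply: Fs; rewrite inE zs orbT.
by exists a; apply: SS' => //; apply: issubB => //; apply: issubZ.
Qed.

Lemma qindep_mono V (S S' : V -> Prop) s :
  (forall z, S' z -> S z) -> qindep S s -> qindep S' s.
Proof. by move=> SS'; apply: (@qindep_restr _ (fun=> True)) => // z _; apply: SS'. Qed.

Lemma qindep_map V W (f : {linear V -> W}) (I : V -> Prop) (S : W -> Prop) s :
  (forall a, S (f a) -> I a) -> qindep I s -> qindep S (map f s).
Proof.
elim: s I S => [//|w s IH] I S SI /= [Iw Is]; split=> [a|].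
  by rewrite -linearZ => /SI; apply: Iw.
by apply: IH Is => a [c]; rewrite -linearZ -linearB => /SI; exists c.
Qed.

Lemma qindep_of_map V W (f : {linear V -> W}) (I : V -> Prop) (S : W -> Prop) s :
  (forall a, I a -> S (f a)) -> qindep S (map f s) -> qindep I s.
Proof.
elim: s I S => [//|w s IH] I S SI /= [Sw Ss]; split=> [a /SI|].
  by rewrite linearZ; apply: Sw.
by apply: IH Ss => a [c /SI]; rewrite linearB linearZ; exists c.
Qed.

Lemma qindep_cat V (S T : V -> Prop) s1 s2 : issub T ->
  (forall z, S z -> T z) -> (forall z, z \in s1 -> T z) ->
  qindep S s1 -> qindep T s2 -> qindep S (s1 ++ s2).
Proof.
move=> HT; elim: s1 S => [|w s IH] S ST sT /=.
  by move=> _; apply: qindep_mono.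
case=> Sw Ss Ts2; split=> //; apply: IH => // [|z zs].
  by apply: adjoin_le => //; apply: sT; rewrite mem_head.
by apply: sT; rewrite inE zs orbT.
Qed.

Definition msum V (S U : V -> Prop) (z : V) : Prop := exists2 u, U u & S (z - u).

(** Subadditivity of length. A term [w] of the sequence either remains
    independent modulo [S + U], or has a multiple [a *: w], with [a] outside
    [q], equal modulo [S] to an element of [U], which then replaces it. *)
Lemma qindep_split V (S U : V -> Prop) s : issub S -> issub U -> qindep S s ->
  exists s1 s2, [/\ forall z, z \in s1 -> U z, forall z, z \in s2 -> z \in s,
    qindep S s1, qindep (msum S U) s2 & size s = (size s1 + size s2)%N].
Proof.
move=> + HU; elim: s S => [|w s IH] S HS /=; first by exists [::], [::].
case=> Sw /(IH _ (adjoin_sub w HS))[s1 [s2 [s1U s2s Ss1 Ss2 ->]]].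
have s2ws z : z \in s2 -> z \in w :: s by rewrite inE orbC => /s2s ->.
have [Uw|/existsNP[a]] := EM (forall a : R, msum S U (a *: w) -> q a).
  exists s1, (w :: s2); split=> //= [z|||]; last by rewrite addnS.
  - by rewrite inE => /predU1P[->|/s2ws]; rewrite ?mem_head.
  - by apply: qindep_mono Ss1; apply: adjoin_in.
  split=> //; apply: qindep_mono Ss2 => z [a [u Uu Su]].
  by exists u => //; exists a; rewrite addrAC.
case/not_implyP => -[u Uu Su] qa; exists (u :: s1), s2; split=> //=.
- by move=> z; rewrite inE => /predU1P[->|/s1U].
- split=> [r Sr|].
    have : S ((r * a) *: w).
      rewrite -scalerA -(subrK (r *: u) (r *: _)) -scalerBr.
      by apply: issubD => //; apply: issubZ.
    by move/Sw/(primeM Pq) => [].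
  apply: qindep_mono Ss1 => z [c Sc]; exists (c * a).
  have -> : z - (c * a) *: w = (z - c *: u) - c *: (a *: w - u).
    by rewrite scalerBr scalerA opprB addrA subrK.
  by apply: issubB => //; apply: issubZ.
- by apply: qindep_mono Ss2 => z [v Uv Sv]; exists v => //; apply: adjoin_in.
Qed.

Definition qlen_le V (S T : V -> Prop) (n : nat) : Prop :=
  forall s, (forall z, z \in s -> T z) -> qindep S s -> (size s <= n)%N.

Lemma qlen_le_add V (S U T : V -> Prop) n1 n2 : issub S -> issub U ->
  qlen_le S U n1 -> qlen_le U T n2 -> qlen_le S T (n1 + n2).
Proof.
move=> HS HU le1 le2 s sT Ss.
have [s1 [s2 [s1U s2s Ss1 Ss2 ->]]] := qindep_split HS HU Ss.
apply: leq_add; first exact: le1.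
apply: le2 => [z /s2s/sT //|]; apply: qindep_mono Ss2 => z Uz.
by exists z; rewrite // subrr; apply: issub0.
Qed.

Lemma qlen_le0 V (S T : V -> Prop) :
  (forall z, T z -> exists2 a : R, ~ q a & S (a *: z)) -> qlen_le S T 0.
Proof.
move=> ST [|z s] // sT [Sz _]; have [|a qa Sa] := ST z; first by apply: sT; rewrite mem_head.
by case: qa; apply: Sz.
Qed.

Section Powers.
Variables (V : lmodType R) (x : R) (F : V -> Prop).
Hypothesis HF : issub F.

Definition layer n (z : V) : Prop := exists2 u, F u & z = x ^+ n *: u.

Lemma layer_sub n : issub (layer n).
Proof.
split=> [|_ _ [u Fu ->] [v Fv ->]|a _ [u Fu ->]].
- by exists 0; [exact: issub0|rewrite scaler0].
- by exists (u + v); [exact: issubD|rewrite scalerDr].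
- by exists (a *: u); [exact: issubZ|rewrite !scalerA mulrC].
Qed.

Lemma layer_list n s : (forall z, z \in s -> layer n z) ->
  exists2 t, forall z, z \in t -> F z & s = map ( *:%R (x ^+ n)) t.
Proof.
elim: s => [|w s IH] sL; first by exists [::].
have [u Fu ->] := sL w (mem_head _ _).
have [z zs|t tF ->] := IH; first by apply: sL; rewrite inE zs orbT.
by exists (u :: t) => // z; rewrite inE => /predU1P[->|/tF].
Qed.

(** Multiplication by [x ^ j] maps the quotient of [F] by [x F] onto that of
    [x ^ j F] by [x ^ (j + 1) F]. *)
Lemma qlen_layer_le b n : qlen_le (layer 1) F b -> qlen_le (layer n) F (n * b).
Proof.
move=> leb; elim: n => [|n IH].
  apply: qlen_le0 => z Fz; exists 1; first exact: prime1.
  by exists z; rewrite // expr0.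
rewrite mulSn; apply: (qlen_le_add (layer_sub _) (layer_sub n)) IH => s.
case/layer_list => t tF -> Lt; rewrite size_map; apply: leb => //.
apply: (qindep_of_map (f := *:%R (x ^+ n))) Lt => _ [u Fu ->].
by exists u; rewrite //= scalerA -exprD addn1.
Qed.

(** When [x] is regular these surjections are isomorphisms. *)
Lemma qlen_layer_ge s n : (forall z : V, x *: z = 0 -> z = 0) ->
  (forall z, z \in s -> F z) -> qindep (layer 1) s ->
  exists t, [/\ forall z, z \in t -> F z, qindep (layer n) t & size t = (n * size s)%N].
Proof.
move=> xreg sF Ls.
have xnreg k (z : V) : x ^+ k *: z = 0 -> z = 0.
  elim: k z => [|k IH] z; first by rewrite scale1r.
  by rewrite exprS -scalerA => /xreg /IH.
elim: n => [|n [t [tF Lt szt]]]; first by exists [::].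
exists (map ( *:%R (x ^+ n)) s ++ t); split.
- move=> z; rewrite mem_cat => /orP[/mapP[u us ->]|/tF //].
  by apply: issubZ => //; apply: sF.
- apply: (qindep_cat (layer_sub n)) Lt => [_ [u Fu ->]|_ /mapP[u us ->]|].
  + by exists (x *: u); [apply: issubZ|rewrite scalerA -exprSr].
  + by exists u => //; apply: sF.
  apply: qindep_map Ls => a /= [u Fu]; rewrite exprSr -scalerA => /eqP.
  rewrite -subr_eq0 -scalerBr => /eqP /xnreg /eqP; rewrite subr_eq0 => /eqP ->.
  by exists u.
- by rewrite size_cat size_map szt mulSn.
Qed.
End Powers.

End LocalLength.

(** * Descent of the rank of the socle along a regular element *)

Section Descent.
Variable R : comNzRingType.
Hypothesis noethR : noetherian R.
Variable V : lmodType R.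

(** The elements of [V / X] killed by [q] span a space of dimension at most one
    after localization at [q]. *)
Definition socle_le1 (q : R^o -> Prop) (X : V -> Prop) : Prop :=
  forall z1 z2, (forall a : R, q a -> X (a *: z1)) -> (forall a : R, q a -> X (a *: z2)) ->
    exists r1 r2 : R, X (r1 *: z1 + r2 *: z2) /\ ~ (q r1 /\ q r2).

Definition killed (X N : V -> Prop) (I : R^o -> Prop) (z : V) : Prop :=
  N z /\ forall a : R, I a -> X (a *: z).

Lemma killed_sub X N I : issub X -> issub N -> issub (killed X N I).
Proof.
move=> HX HN; apply: issubI => //; split=> [a _|x y Ix Iy a Ia|c x Ix a Ia].
- by rewrite scaler0; apply: issub0.
- by rewrite scalerDr; apply: issubD => //; [apply: Ix|apply: Iy].
- by rewrite scalerA mulrC -scalerA; apply: issubZ => //; apply: Ix.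
Qed.

(** When the socle at [q] is at most one-dimensional, the part of [V / X] killed
    by [I] is no longer at [q] than [R / I]: along a prime filtration of [R / I],
    each factor [R / p] accounts for a subquotient embedding into the elements of
    [V / X] killed by [p]. The list [t] records the factors with [p] equal to [q];
    since [q] is minimal over [J], all others vanish at [q]. *)
Lemma qlen_killed (q J : R^o -> Prop) (X N : V -> Prop) :
  isprime q -> issub X -> issub N -> socle_le1 q X ->
  (forall p, prime_over J p -> (forall a, p a -> q a) -> forall a, q a -> p a) ->
  forall I, issub I -> (forall a, J a -> I a) ->
  exists t : seq R^o, [/\ qindep q I t, qlen_le q X (killed X N I) (size t) &
    (forall a, I a -> q a) -> (0 < size t)%N].
Proof.
move=> Pq HX HN soc qmin; apply: (ideal_ind noethR) => I HI IH JI.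
have [I1|nI1] := EM (I 1).
  exists [::]; split=> // [|Iq]; last by case: (prime1 Pq); apply: Iq.
  apply: qlen_le0 => z [_ Iz]; exists 1; first exact: prime1.
  exact: Iz.
have [a0 Pp] := assoc_prime noethR (z0 := (1 : R^o)) HI nI1.
set a : R := a0 *: (1 : R^o) in Pp; set p := (fun _ => _) in Pp.
have nIa : ~ I a by move=> Ia; apply: (prime1 Pp); rewrite /p scale1r.
have Ip b : I b -> p b by move=> Ib; apply: ideal_mulr.
have [|b Ib|aI|b Jb|t [tI tN tq]] := IH (adjoin I a).
- exact: adjoin_sub.
- exact: adjoin_in.
- by apply/nIa/aI/adjoin_gen.
- by apply/adjoin_in/JI.
have HK := killed_sub (adjoin I a) HX HN.
have killedI (b : R) z : p b -> killed X N I z -> killed X N (adjoin I a) (b *: z).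
  move=> pb [Nz Iz]; split; first exact: (issubZ HN).
  move=> c [d Icd]; rewrite scalerA -(subrK (b * (d * a)) (c * b)) scalerDl.
  apply: issubD => //; apply: Iz.
    by rewrite [b * _]mulrC -mulrBl; exact: (ideal_mulr b HI Icd).
  by rewrite mulrCA; exact: (ideal_mull d HI pb).
have [pq|/existsNP[b /not_implyP[pb qb]]] := EM (forall b, p b -> q b); last first.
  (* localizing at [q] makes the step from [I] to [adjoin I a] trivial *)
  exists t; split=> [||Iq].
  - exact: qindep_mono (@adjoin_in _ _ _ _) tI.
  - rewrite -[size t]addn0; apply: (qlen_le_add Pq HX HK tN).
    by apply: qlen_le0 => z Iz; exists b => //; apply: killedI.
  apply: tq => c [d Icd]; apply: (issubBr (prime_sub Pq)) (Iq _ Icd).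
  have [|//|] := primeM Pq (a := b) (b := a); last by move=> qa; apply: ideal_mull (prime_sub Pq) qa.
  exact: Iq.
have qp b : q b -> p b.
  by apply: qmin => //; split=> // c /JI; apply: Ip.
exists (a :: t); split=> //=; rewrite -addn1.
apply: (qlen_le_add Pq HX HK tN) => -[|z1 [|z2 s]] //= sI [U1 [U2 _]].
have [N1 I1] := sI z1 (mem_head _ _).
have [N2 I2] : killed X N I z2 by apply: sI; rewrite !inE eqxx orbT.
have [b qb|b qb|r1 [r2 [Xr nr]]] := soc (a *: z1) (a *: z2).
- by rewrite scalerA; apply: I1; apply: qp.
- by rewrite scalerA; apply: I2; apply: qp.
have swap (e : R) : e *: (r1 *: z1 + r2 *: z2) = r1 *: (e *: z1) + r2 *: (e *: z2).
  by rewrite scalerDr !scalerA ![e * _]mulrC.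
have Uw : killed X N (adjoin I a) (r1 *: z1 + r2 *: z2).
  split=> [|c [d Icd]]; first by apply: (issubD HN); apply: (issubZ HN).
  rewrite -(subrK (d * a) c) scalerDl; apply: (issubD HX).
    rewrite swap; apply: (issubD HX); apply: (issubZ HX); [exact: I1|exact: I2].
  by rewrite -scalerA swap; apply: (issubZ HX).
have q2 : q r2 by apply: U2; exists (- r1); rewrite scaleNr opprK addrC.
have q1 : q r1.
  apply: U1; rewrite -(addrK (r2 *: z2) (r1 *: z1)); apply: issubB => //.
  by apply: killedI => //; apply: qp.
by case: nr.
Qed.

Definition orbit_map (y : V) (a : R^o) : V := (a : R) *: y.

Fact orbit_map_linear y : linear (orbit_map y).
Proof. by move=> c a b; rewrite /orbit_map scalerDl scalerA. Qed.

HB.instance Definition _ y :=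
  GRing.isLinear.Build R R^o V _ (orbit_map y) (orbit_map_linear y).

(** Suppose that the part [N] of [V] killed by [p] contains a free [R / p]-module
    [F] of rank two. At a minimal prime [q] over [p + x R], the one-dimensional
    socle of [V / x V] bounds the length of [N / x ^ n N] by [n * b], where [b] is
    the length of [R / (p + x R)]. But [x ^ n N] meets [F] inside
    [x ^ (n - n0) F] for a constant [n0], so this length is at least that of
    [F / x ^ (n - n0) F], which is [2 * (n - n0) * b]. *)
Lemma socle_descent (p : R^o -> Prop) (x : R) :
  fin_gen V -> isprime p -> (forall z : V, x *: z = 0 -> z = 0) -> ~ adjoin p x 1 ->
  (forall q, isprime q -> (forall a, p a -> q a) -> q x ->
    socle_le1 q (fun z => exists u, z = x *: u)) ->
  socle_le1 p (fun z => z = 0).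
Proof.
move=> fgV Pp xreg px1 socq y1 y2 py1 py2; apply: contrapT => free.
have indep (r1 r2 : R) : r1 *: y1 + r2 *: y2 = 0 -> p r1 /\ p r2.
  by move=> r0; apply: contrapT => nr; apply: free; exists r1, r2.
have HJ := adjoin_sub (x : R^o) (prime_sub Pp).
have [q [Pq Jq] qmin] := minimal_prime noethR HJ px1.
pose X (z : V) := exists u : V, z = x *: u.
pose N (z : V) := forall a : R, p a -> a *: z = 0.
pose F (z : V) := exists a1 a2 : R, z = a1 *: y1 + a2 *: y2.
have HX : issub X.
  split=> [|_ _ [u ->] [v ->]|a _ [u ->]]; first by exists 0; rewrite scaler0.
    by exists (u + v); rewrite scalerDr.
  by exists (a *: u); rewrite !scalerA mulrC.
have HN : issub N.
  split=> [a _|u v Nu Nv a pa|c u Nu a pa]; first by rewrite scaler0.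
    by rewrite scalerDr Nu ?Nv ?addr0.
  by rewrite scalerA mulrC -scalerA Nu ?scaler0.
have HF : issub F.
  split=> [|_ _ [a1 [a2 ->]] [b1 [b2 ->]]|c _ [a1 [a2 ->]]].
  - by exists 0, 0; rewrite !scale0r addr0.
  - by exists (a1 + b1), (a2 + b2); rewrite !scalerDl addrACA.
  - by exists (c * a1), (c * a2); rewrite scalerDr !scalerA.
have FN z : F z -> N z.
  case=> a1 [a2 ->] a pa.
  rewrite scalerDr !scalerA ![a * _]mulrC -!scalerA.
  by rewrite py1 ?py2 // !scaler0 addr0.
have soc : socle_le1 q X.
  by apply: socq => // [a pa|]; apply: Jq; [exact: adjoin_in|exact: adjoin_gen (prime_sub Pp)].
have [t [tJ tN /(_ Jq) t0]] := qlen_killed Pq HX HN soc qmin HJ (fun a Ja => Ja).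
(* [p + x R] maps [N] into [x V], and [N] meets [x V] in [x N] as [x] is regular *)
have upper n : qlen_le q (layer x N n) N (n * size t).
  apply: qlen_layer_le => // s sN Ls; apply: tN => [z zs|].
    split=> [|a [c pac]]; first exact: sN.
    exists (c *: z); rewrite -(subrK (c * x) a) scalerDl (sN z zs _ pac) add0r.
    by rewrite scalerA mulrC.
  apply: (qindep_restr HN) Ls => // z Nz [u zE]; exists u; rewrite // => a pa.
  by apply: xreg; rewrite scalerA mulrC -scalerA -zE Nz.
(* as [y1] and [y2] are free over [R / p], the sequence [t] can be used on each of them *)
have base : exists2 s, (forall z, z \in s -> F z) &
    qindep q (layer x F 1) s /\ size s = (size t + size t)%N.
  pose T := adjoin (layer x F 1) y1.
  have HT : issub T by apply/adjoin_sub/layer_sub.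
  exists (map (orbit_map y1) t ++ map (orbit_map y2) t); last first.
    split; last by rewrite size_cat !size_map.
    apply: (qindep_cat HT) => [|||].
    - exact: adjoin_in.
    - move=> _ /mapP[a _ ->]; apply: issubZ => //; exact: adjoin_gen (layer_sub _ HF _).
    - apply: qindep_map tJ => a [_ [a1 [a2 ->]]]; rewrite /= /orbit_map expr1 => E.
      have [|pa _] := indep (a - x * a1) (- (x * a2)).
        by rewrite scalerBl E scalerDr !scalerA scaleNr [X in X - _ - _]addrC addrK subrr.
      by exists a1; rewrite [_ *: _]mulrC.
    - apply: qindep_map tJ => a [c [_ [a1 [a2 ->]]]]; rewrite /= /orbit_map expr1 => E.
      have [|_ pa] := indep (- c - x * a1) (a - x * a2).
        rewrite !scalerBl scaleNr addrACA [- _ + _]addrC E.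
        by rewrite scalerDr !scalerA -opprD subrr.
      by exists a2; rewrite [_ *: _]mulrC.
  move=> z; rewrite mem_cat => /orP[] /mapP[a _ ->] /=.
    by exists a, 0; rewrite scale0r addr0.
  by exists 0, a; rewrite scale0r add0r.
case: base => s0 s0F [Ls0 szs0].
(* [n0] is where the submodules of elements sent into [F] by [x ^+ n] become stationary *)
pose P (T : V -> Prop) := exists n, T = (fun z => F (x ^+ n *: z)).
have [||T [n0 ->] n0max] := fg_max noethR (P := P) (S0 := fun z => F (x ^+ 0 *: z)) fgV.
- move=> _ [n ->]; split=> [|u v Fu Fv|a u Fu]; first by rewrite scaler0; exact: issub0.
    by rewrite scalerDr; apply: issubD.
  by rewrite scalerA mulrC -scalerA; apply: issubZ.
- by exists 0%N.
have stat m z : F (x ^+ (m + n0) *: z) -> F (x ^+ n0 *: z).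
  apply: (n0max (fun z => F (x ^+ (m + n0) *: z))) => [|u Fu]; first by exists (m + n0)%N.
  by rewrite exprD -scalerA; apply: issubZ.
(* the two bounds contradict each other for [n = n0 + 1 + n0] *)
have [s [sF Ls szs]] := qlen_layer_ge HF n0.+1 xreg s0F Ls0.
have := upper (n0.+1 + n0)%N s (fun z zs => FN z (sF z zs)).
rewrite szs szs0 => le; suff /le : qindep q (layer x N (n0.+1 + n0)) s by nia.
apply: (qindep_restr HF sF) Ls => z Fz [u _ zE].
exists (x ^+ n0 *: u); first by apply: (stat n0.+1); rewrite -zE.
by rewrite scalerA -exprD.
Qed.
End Descent.

(** * Ext and the passage to the quotient by a regular element *)

Section Classes.
Variable R : comNzRingType.
Implicit Types (U V W K N : lmodType R) (m : ideal R).
Local Open Scope quotient_scope.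

Lemma pi_eq0 V (S : submodClosed V) (x : V) :
  \pi_(quotmod S) x = 0 <-> x \in S.
Proof.
split=> [px|xS].
  have /eqP : \pi_(quotmod S) x = \pi_(quotmod S) 0 by rewrite px raddf0.
  by rewrite piE /Quotient.equiv subr0.
rewrite -(raddf0 (\pi_(quotmod S))); apply/eqP.
by rewrite piE /Quotient.equiv subr0.
Qed.

Lemma pi_linear V (S : submodClosed V) : linear (\pi_(quotmod S)).
Proof. by move=> a x y; rewrite raddfD /= pi_qscale. Qed.

Definition quot_map V (S : submodClosed V) (x : V) : quotmod S := \pi_(quotmod S) x.
HB.instance Definition _ V (S : submodClosed V) :=
  GRing.isLinear.Build R V (quotmod S) _ (@quot_map V S) (@pi_linear V S).

Lemma quot_map_eq0 V (S : submodClosed V) (x : V) : quot_map S x = 0 <-> x \in S.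
Proof. exact: pi_eq0. Qed.

Lemma quot_map_surj V (S : submodClosed V) (y : quotmod S) : exists x, quot_map S x = y.
Proof. by exists (repr y); rewrite /quot_map reprK. Qed.

Lemma homology_trivial U V W (f : {linear U -> V}) (g : {linear V -> W}) z :
  lmod_trivial (homology f g) -> g z = 0 -> exists x, f x = z.
Proof.
move=> triv gz; have kz : z \in mker g by rewrite inE gz.
have /quot_map_eq0 := triv (quot_map (boundaries f (g := g)) (Submod kz)).
by move=> /asboolP.
Qed.

Lemma homology_residue m U V W (f : {linear U -> V}) (g : {linear V -> W}) z1 z2 :
  1 \notin m -> lmod_iso (homology f g) (residue_field m) ->
  g z1 = 0 -> g z2 = 0 ->
  exists r1 r2 : R, (exists x, f x = r1 *: z1 + r2 *: z2) /\ ~ (r1 \in m /\ r2 \in m).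
Proof.
move=> m1 [h /bij_inj hinj] gz1 gz2.
have k1 : z1 \in mker g by rewrite inE gz1.
have k2 : z2 \in mker g by rewrite inE gz2.
pose u1 : homology f g := quot_map (boundaries f (g := g)) (Submod k1).
pose u2 : homology f g := quot_map (boundaries f (g := g)) (Submod k2).
have [a1 a1E] := quot_map_surj (h u1); have [a2 a2E] := quot_map_surj (h u2).
suff [r1 [r2 [hr nr]]] : exists r1 r2 : R,
    quot_map m (r1 * a1 + r2 * a2) = 0 /\ ~ (r1 \in m /\ r2 \in m).
  exists r1, r2; split=> //.
  have : h (r1 *: u1 + r2 *: u2) = h 0.
    by rewrite linear0 linearD !linearZ -a1E -a2E -!linearZ -linearD.
  by move/hinj; rewrite -!linearZ -linearD => /quot_map_eq0/asboolP.
have [am|am] := boolP (a1 \in m).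
  exists 1, 0; rewrite mul0r addr0 mul1r; split; first exact/quot_map_eq0.
  by case; rewrite (negPf m1).
exists a2, (- a1); split; first by rewrite mulNr mulrC subrr linear0.
by case=> _ /(issubN (issub_mem m)); rewrite opprK (negPf am).
Qed.

Definition malg_ext (X : choiceType) N (h : X -> N) (c : {malg R[X]}) : N :=
  \sum_(k <- msupp c) c@_k *: h k.

Fact malg_ext_linear (X : choiceType) N (h : X -> N) : linear (malg_ext h).
Proof.
move=> a c1 c2; pose E := (msupp c1 `|` msupp c2)%fset.
have extE c : (msupp c `<=` E)%fset -> malg_ext h c = \sum_(x <- E) c@_x *: h x.
  move=> cE; rewrite /malg_ext (big_fset_incl _ cE) // => x _ xc.
  by rewrite mcoeff_outdom // scale0r.
rewrite !extE ?fsubsetUl ?fsubsetUr //; last first.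
  apply: fsubset_trans (msuppD_le _ _) _.
  by rewrite fsetSU // msuppZ_le.
rewrite scaler_sumr -big_split; apply: eq_bigr => x _ /=.
by rewrite mcoeffD mcoeffZ scalerDl scalerA.
Qed.
HB.instance Definition _ (X : choiceType) N (h : X -> N) :=
  GRing.isLinear.Build R {malg R[X]} N _ (malg_ext h) (malg_ext_linear h).

Lemma malg_extE (X : choiceType) N (f : {linear {malg R[X]} -> N}) c :
  f c = malg_ext (fun k => f << 1 *g k >>) c.
Proof.
rewrite {1}[c]monalgE linear_sum /malg_ext; apply: eq_bigr => k _.
rewrite -linearZ; congr (f _); apply/malgP => k'.
by rewrite mcoeffZ !mcoeffU mulrnAr mulr1.
Qed.

Lemma malg_lift (X : choiceType) V W (g : {linear V -> W}) (f : {linear {malg R[X]} -> W}) :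
  (forall y, exists x, g x = y) ->
  exists f' : {linear {malg R[X]} -> V}, forall c, g (f' c) = f c.
Proof.
move=> gsurj; have [s sP] := choice gsurj.
exists (malg_ext (fun k => s (f << 1 *g k >>))) => c.
rewrite [RHS]malg_extE /= /malg_ext linear_sum; apply: eq_bigr => k _.
by rewrite linearZ sP.
Qed.

Definition cocycle K N i (f : Defs.Hom (resolution K i) N) : Prop := Ext_d K N i f = 0.

Definition coboundary K N i : Defs.Hom (resolution K i) N -> Prop :=
  if i is j.+1 then fun f => exists e, Ext_d K N j e = f else fun f => f = 0.

Lemma cocycleP K N i (f : Defs.Hom (resolution K i) N) :
  cocycle f <-> forall c, (f : {linear _ -> _}) (resolution_d K i c) = 0.
Proof.
split=> [f0 c|f0]; last by apply: hom_ext => c; apply: f0.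
exact: (congr1 (fun g : Defs.Hom _ _ => (g : {linear _ -> _}) c) f0).
Qed.

Lemma free_evalK K (c : free_cover (first_syzygy K)) : free_eval (free_d K c) = 0.
Proof. exact/eqP/(valP (free_eval c)). Qed.

Lemma free_dd K c : free_d K (free_d (first_syzygy K) c) = 0.
Proof. exact: etrans (congr1 val (free_evalK c)) (raddf0 val). Qed.

Lemma resolution_dd K i c : resolution_d K i (resolution_d K i.+1 c) = 0.
Proof. exact (@free_dd (syzygy K i) c). Qed.

Definition apply_hom K N (f : Defs.Hom K N) (x : K) : N := (f : {linear K -> N}) x.

Lemma Ext_trivial_coboundary K N i (f : Defs.Hom (resolution K i) N) :
  lmod_trivial (Ext i K N) -> cocycle f -> coboundary f.
Proof.
by case: i f => [|i] f triv /(homology_trivial triv) // [e <-].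
Qed.

Lemma Ext_residue_coboundary m K N i (f1 f2 : Defs.Hom (resolution K i) N) :
  1 \notin m -> lmod_iso (Ext i K N) (residue_field m) ->
  cocycle f1 -> cocycle f2 ->
  exists r1 r2 : R, coboundary (r1 *: f1 + r2 *: f2) /\ ~ (r1 \in m /\ r2 \in m).
Proof.
case: i f1 f2 => [|i] f1 f2 m1 iso c1 c2;
  have [r1 [r2 [[e ef] nr]]] := homology_residue m1 iso c1 c2; exists r1, r2; split=> //.
by exists e.
Qed.

End Classes.

Section RegularQuotient.
Variable R : comNzRingType.
Implicit Types (K N : lmodType R) (m : ideal R).

Definition ext_zero K N i : Prop :=
  forall f : Defs.Hom (resolution K i) N, cocycle f -> coboundary f.

Definition ext_le1 m K N i : Prop :=
  forall f1 f2 : Defs.Hom (resolution K i) N, cocycle f1 -> cocycle f2 ->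
  exists r1 r2 : R, coboundary (r1 *: f1 + r2 *: f2) /\ ~ (r1 \in m /\ r2 \in m).

Variables (M : lmodType R) (x : R).
Hypothesis xreg : forall z : M, x *: z = 0 -> z = 0.

Definition multiples : submodClosed M := mim ( *:%R x : {linear M -> M}).

Lemma multiplesP z : z \in multiples <-> exists u, z = x *: u.
Proof. by split=> [/asboolP[u <-]|[u ->]]; [exists u|apply/asboolP; exists u]. Qed.

Definition reduce U (F : Defs.Hom U M) : Defs.Hom U (quotmod multiples) :=
  quot_map multiples \o (F : {linear U -> M}).

Fact reduce_linear U : linear (@reduce U).
Proof. by move=> a f g; apply: hom_ext => u /=; rewrite linearP. Qed.

HB.instance Definition _ U :=
  GRing.isLinear.Build R (Defs.Hom U M) (Defs.Hom U (quotmod multiples)) _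
    (@reduce U) (@reduce_linear U).

(** The connecting map of [0 -> M -> M -> M / x M -> 0] on cochains: the
    differential of a lift [F] of [f] vanishes modulo [x], and [g] is its
    quotient by [x]. *)
Lemma connecting_cocycle K i (f : Defs.Hom (resolution K i) (quotmod multiples)) :
  cocycle f -> exists F g, [/\ reduce F = f, Ext_d K M i F = x *: g & cocycle g].
Proof.
move=> /cocycleP f0.
have [F FE] := malg_lift (f : {linear {malg R[syzygy K i]} -> _}) (@quot_map_surj _ _ multiples).
have divx c : exists u, F (resolution_d K i c) = x *: u.
  by apply/multiplesP/quot_map_eq0; rewrite FE f0.
have [g gE] := choice divx.
have glin : linear g.
  move=> a c1 c2; apply/eqP; rewrite -subr_eq0; apply/eqP/xreg.
  rewrite scalerBr -gE linearP linearP !gE scalerDr.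
  by rewrite !scalerA mulrC subrr.
pose g' : {linear resolution K i.+1 -> M} := HB.pack_for {linear resolution K i.+1 -> M} g
  (GRing.isLinear.Build R _ M _ g glin).
exists (F : Defs.Hom (resolution K i) M), (g' : Defs.Hom _ _); split.
- by apply: hom_ext => c; apply: FE.
- by apply: hom_ext => c; apply: gE.
- apply/cocycleP => c; apply: xreg.
  by rewrite -[LHS]gE resolution_dd linear0.
Qed.

(** A cochain [h] with coboundary [g] corrects the lift [F] to a cocycle
    [F - x *: h] with the same reduction, and all cocycles of [M] in this degree
    are coboundaries. *)
Lemma connecting_injective K i (F : Defs.Hom (resolution K i) M) g :
  ext_zero K M i -> Ext_d K M i F = x *: g -> coboundary g -> coboundary (reduce F).
Proof.
move=> ext0 FE [h hg].
have reducex U (e : Defs.Hom U M) : reduce (x *: e) = 0.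
  by apply: hom_ext => u; apply/quot_map_eq0/multiplesP; exists ((e : {linear U -> M}) u).
have : cocycle (F - x *: h) by rewrite /cocycle linearB linearZ FE hg subrr.
have -> : reduce F = reduce (F - x *: h).
  have -> : reduce (F - x *: h) = reduce F - reduce (x *: h) by exact: linearB.
  by rewrite reducex subr0.
move: (F - x *: h) => G /ext0; case: i {F g h ext0 FE hg} G => [|i] G /=.
  by move=> ->; rewrite linear0.
by case=> e <-; exists (reduce e); apply: hom_ext.
Qed.

Lemma ext_zero_quot K i :
  ext_zero K M i -> ext_zero K M i.+1 -> ext_zero K (quotmod multiples) i.
Proof.
move=> ext0 ext1 f /connecting_cocycle[F [g [<- FE cg]]].
exact: connecting_injective FE (ext1 _ cg).
Qed.

Lemma ext_le1_quot m K i :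
  ext_zero K M i -> ext_le1 m K M i.+1 -> ext_le1 m K (quotmod multiples) i.
Proof.
move=> ext0 ext1 f1 f2.
move=> /connecting_cocycle[F1 [g1 [<- FE1 cg1]]] /connecting_cocycle[F2 [g2 [<- FE2 cg2]]].
have [r1 [r2 [cb nr]]] := ext1 _ _ cg1 cg2; exists r1, r2; split=> //.
rewrite -!linearZ -linearD; apply: (connecting_injective ext0) cb.
by rewrite linearD !linearZ FE1 FE2 /= scalerDr !scalerA ![x * _]mulrC.
Qed.

End RegularQuotient.

Section ExtZero.
Variable R : comNzRingType.
Variables (m : ideal R) (N : lmodType R).
Local Open Scope quotient_scope.

Lemma residue_repr (a : R^o) : a - repr (quot_map m a) \in m.
Proof. by apply/quot_map_eq0; rewrite linearB /= /quot_map reprK subrr. Qed.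

Definition residue_hom (z : N) (u : residue_field m) : N := (repr u : R) *: z.

Lemma residue_homE z (a : R^o) : (forall a : R, a \in m -> a *: z = 0) ->
  residue_hom z (quot_map m a) = (a : R) *: z.
Proof.
move=> mz; apply/eqP; rewrite -subr_eq0 /residue_hom -scalerBl -opprB scaleNr.
by rewrite mz ?oppr0 // residue_repr.
Qed.

Lemma residue_hom_linear z : (forall a : R, a \in m -> a *: z = 0) ->
  linear (residue_hom z).
Proof.
move=> mz a u v; have [b <-] := quot_map_surj u; have [c <-] := quot_map_surj v.
by rewrite -linearP !residue_homE // scalerDl scalerA.
Qed.

Lemma free_eval_surj (K : lmodType R) (y : K) : exists c : free_cover K, free_eval c = y.
Proof.
exists << 1 *g y >>; rewrite /free_eval msuppU oner_eq0 big_seq_fset1.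
by rewrite mcoeffUU scale1r.
Qed.

Lemma socle_hom z : (forall a : R, a \in m -> a *: z = 0) ->
  exists h : {linear residue_field m -> N}, h (quot_map m 1) = z.
Proof.
move=> mz; exists (HB.pack_for {linear residue_field m -> N} (residue_hom z)
  (GRing.isLinear.Build R _ N _ (residue_hom z) (residue_hom_linear mz))).
by rewrite /= residue_homE ?scale1r.
Qed.

Definition socle_cochain (h : {linear residue_field m -> N}) :
    Defs.Hom (resolution (residue_field m) 0) N :=
  h \o @free_eval R (residue_field m).

Lemma socle_cocycle h : cocycle (socle_cochain h).
Proof.
apply/cocycleP => c.
exact (etrans (congr1 h (@free_evalK R (residue_field m) c)) (linear0 h)).
Qed.

Lemma ext_zero_socle : ext_zero (residue_field m) N 0 ->
  forall z : N, (forall a : R, a \in m -> a *: z = 0) -> z = 0.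
Proof.
move=> ext0 z /socle_hom[h <-]; have [c <-] := free_eval_surj (quot_map m 1 : residue_field m).
have f0 : socle_cochain h = 0 := ext0 _ (socle_cocycle h).
exact (congr1 (fun f => apply_hom f c) f0).
Qed.

Lemma ext_le1_socle : ext_le1 m (residue_field m) N 0 ->
  socle_le1 (fun a => a \in m) (fun z : N => z = 0).
Proof.
move=> ext1 _ _ /socle_hom[h1 <-] /socle_hom[h2 <-].
have [c <-] := free_eval_surj (quot_map m 1 : residue_field m).
have [r1 [r2 [f0 nr]]] := ext1 _ _ (socle_cocycle h1) (socle_cocycle h2).
exists r1, r2; split=> //.
exact (congr1 (fun f => apply_hom f c) f0).
Qed.
End ExtZero.

(** * Local rings and chains of primes *)

Section LocalRing.
Variable R : comNzRingType.
Variable m : ideal R.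
Hypothesis noethR : noetherian R.
Hypothesis locR : is_local_ring m.

Lemma fin_gen_quot (M : lmodType R) (S : submodClosed M) :
  fin_gen M -> fin_gen (quotmod S).
Proof.
case=> s sM; exists (map (quot_map S) s) => y; have [x <-] := quot_map_surj y.
exact/spn_spanned/spn_map/spanned_spn.
Qed.

Lemma proper_ideal_sub (I : R^o -> Prop) : issub I -> ~ I 1 -> forall a, I a -> a \in m.
Proof.
move=> HI nI a Ia.
pose P (J : R^o -> Prop) := [/\ issub J, ~ J 1 & forall a, I a -> J a].
have [||J [HJ nJ IJ] Jmax] := fg_max noethR (P := P) (S0 := I) (regular_fg R).
- by move=> ? [].
- by [].
have Jm : maximal_ideal (subOf HJ).
  split=> [|K JK K1 b bK]; first exact/subOfP.
  apply/subOfP; apply: (Jmax (fun b => b \in K)) => //.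
    split=> [||c /IJ Jc]; [exact: issub_mem|exact/negP|].
    by apply: JK; apply/subOfP.
  by move=> c Jc; apply: JK; apply/subOfP.
by rewrite -(locR.2 _ Jm); apply/subOfP/IJ.
Qed.

Lemma local_notin1 : 1 \notin m.
Proof. by case: locR => -[]. Qed.

Lemma local_prime : isprime (fun a => a \in m).
Proof.
split=> [||a b abm]; [exact: issub_mem|exact/negP/local_notin1|].
have [am|am] := boolP (a \in m); [by left|right].
have Hm := issub_mem m.
have [c mc] : adjoin (fun a => a \in m) (a : R^o) 1.
  apply: contrapT => n1; case/negP: am.
  by apply: (proper_ideal_sub (adjoin_sub (a : R^o) Hm) n1); apply: adjoin_gen.
have -> : b = b * (1 - c * a) + c * (a * b) by ring.
by apply: (issubD Hm); [exact: (ideal_mull b Hm mc)|exact: (ideal_mull c Hm abm)].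
Qed.

Lemma prime_sub_local p : isprime p -> forall a, p a -> a \in m.
Proof. by move=> Pp; apply: proper_ideal_sub (prime_sub Pp) (prime1 Pp). Qed.

(** A zero divisor of [M] lies in an associated prime; as [M] has no element
    killed by [m], prime avoidance gives an element of [m] outside all of
    them. *)
Lemma regular_element (M : lmodType R) : fin_gen M ->
  (forall z : M, (forall a : R, a \in m -> a *: z = 0) -> z = 0) ->
  exists2 x : R, x \in m & forall z : M, x *: z = 0 -> z = 0.
Proof.
move=> fgM soc0; have [s [sP sAss]] := finite_assoc noethR fgM.
have [||||y /sP Py|x xP] := module_avoidance (V := submod m) (s := s)
    (p := @annih _ _) (bad := fun y v => annih y (val v)) sP.
- move=> y _; split=> [|u v yu yv|a u yu].
  + exact: issub0 (annih_sub y).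
  + exact: (issubD (annih_sub y)).
  + exact: (issubZ (annih_sub y)).
- move=> y c v _ yc; rewrite -[val _]/(c * val v : R).
  exact (@ideal_mulr R (annih y) (val v) c (annih_sub y) yc).
- by move=> y c v /sP Py nyc /(primeM Py (a := c) (b := val v))[].
- by move=> y y' _ _ yy' _ v /yy'.
- apply: contrapT => nb; apply: (annih0 Py); apply: soc0 => a am.
  by apply: contrapT => ya; apply: nb; exists (Submod am).
exists (val x); first exact: (valP x).
move=> z xz; apply: contrapT => nz.
have [r Pr] := assoc_prime noethR (zero_sub M) nz.
have [y ys yr] := sAss _ Pr; apply: (xP y ys); apply/yr.
by rewrite /annih scalerA mulrC -scalerA xz scaler0.
Qed.

(** The dimension of [R / p] is at most [d]; peeling off the first inclusion of a
    chain matches the induction of [ext_socle_le1]. *)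
Fixpoint coht_le (d : nat) (p : R^o -> Prop) : Prop :=
  forall q, [/\ isprime q, forall a, p a -> q a & ~ forall a, q a -> p a] ->
    if d is d'.+1 then coht_le d' q else False.

Lemma prime_chain_cons n (c : nat -> ideal R) p (HP : issub p) : isprime p -> prime_chain n c ->
  (forall a, p a -> a \in c 0%N) -> ~ (forall a, a \in c 0%N -> p a) ->
  prime_chain n.+1 (fun i => if i is j.+1 then c j else subOf HP).
Proof.
move=> Pp [cP cS] pc ncp; split=> [[|i] ilt|[|i] ilt]; last exact: cS.
- split; first by apply/subOfP; apply: prime1 Pp.
  move=> a b /(subOfP HP) /(primeM Pp)[pa|pb]; apply/orP; [left|right]; exact/(subOfP HP).
- exact: cP.
- split=> [a /(subOfP HP) /pc //|H]; apply: ncp => a /H /(subOfP HP) pa.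
  exact: pa.
Qed.

Lemma prime_chain_from d p (HP : issub p) : isprime p -> ~ coht_le d p ->
  exists2 c : nat -> ideal R, prime_chain d.+1 c & c 0%N = subOf HP.
Proof.
have step n (c : nat -> ideal R) q (HQ : issub q) (p' : R^o -> Prop) (HP' : issub p') : isprime p' ->
    (forall a, p' a -> q a) -> ~ (forall a, q a -> p' a) ->
    prime_chain n c -> c 0%N = subOf HQ ->
    exists2 c' : nat -> ideal R, prime_chain n.+1 c' & c' 0%N = subOf HP'.
  move=> Pp' pq nqp cc c0; exists (fun i => if i is j.+1 then c j else subOf HP') => //.
  apply: prime_chain_cons => //; rewrite c0.
    by move=> a /pq qa; apply/(subOfP HQ).
  by move=> H; apply: nqp => a qa; apply: H; apply/(subOfP HQ).
elim: d p HP => [|d IH] p HP Pp /existsNP[q /not_implyP[[Pq pq nqp] nd]].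
  apply: (step 0%N (fun _ => subOf (prime_sub Pq)) q (prime_sub Pq)) => //.
  split=> // i _; split; first by apply/subOfP; apply: prime1 Pq.
  by move=> a b /(subOfP (prime_sub Pq)) /(primeM Pq)[pa|pb]; apply/orP; [left|right]; exact/(subOfP (prime_sub Pq)).
have [c cc c0] := IH q (prime_sub Pq) Pq nd.
exact: step c0.
Qed.

Lemma krull_coht_le d p : has_krull_dim R d -> isprime p -> coht_le d p.
Proof.
move=> [_ dP] Pp; apply: contrapT => nd.
have [c /dP] := prime_chain_from (prime_sub Pp) Pp nd.
by rewrite ltnn.
Qed.

Lemma socle_le1_quot q (M : lmodType R) (S : submodClosed M) (X : M -> Prop) :
  (forall z, z \in S <-> X z) ->
  socle_le1 q (fun z : quotmod S => z = 0) -> socle_le1 q X.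
Proof.
move=> SX soc z1 z2 qz1 qz2.
have [a qa|a qa|r1 [r2 [r0 nr]]] := soc (quot_map S z1) (quot_map S z2).
- by rewrite -linearZ; apply/quot_map_eq0/SX/qz1.
- by rewrite -linearZ; apply/quot_map_eq0/SX/qz2.
by exists r1, r2; split=> //; apply/SX/quot_map_eq0; rewrite linearD !linearZ.
Qed.

(** Induction on [d], passing to the quotient by a regular element [x] of [m]. A
    prime over [p] and [x] is strictly larger than [p] unless [x] lies in [p], in
    which case regularity leaves no nonzero element killed by [p]. *)
Lemma ext_socle_le1 d (M : lmodType R) p : fin_gen M -> isprime p -> coht_le d p ->
  (forall i, (i < d)%N -> ext_zero (residue_field m) M i) ->
  ext_le1 m (residue_field m) M d -> socle_le1 p (fun z : M => z = 0).
Proof.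
elim: d M p => [|d IH] M p fgM Pp hd ext0 ext1.
  have mp a : a \in m -> p a.
    apply: contrapT.
    have [|mp] := EM (forall a, a \in m -> p a); first by move=> mp; apply; apply: mp.
    by case: (hd (fun a => a \in m)); split=> //; [exact: local_prime|exact: prime_sub_local].
  move=> z1 z2 pz1 pz2.
  have [a /mp|a /mp|r1 [r2 [r0 nr]]] := ext_le1_socle ext1 (z1 := z1) (z2 := z2).
  - exact: pz1.
  - exact: pz2.
  by exists r1, r2; split=> // -[p1 p2]; apply: nr; split; apply: (prime_sub_local Pp).
have [x mx xreg] := regular_element fgM (ext_zero_socle (ext0 0%N isT)).
have [px|npx] := EM (p x).
  move=> z1 z2 pz1 _; exists 1, 0; split=> [|[/(prime1 Pp) //]].
  by rewrite (xreg z1 (pz1 x px)) scaler0 scale0r addr0.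
apply: (socle_descent noethR fgM Pp xreg) => [|q Pq pq qx].
  move=> /(adjoin_le (issub_mem m) (prime_sub_local Pp) mx).
  exact/negP/local_notin1.
apply: (socle_le1_quot (multiplesP x)).
apply: IH => //.
- exact: fin_gen_quot.
- by apply: hd; split=> // qp; apply: npx; apply: qp.
- by move=> i id; apply: ext_zero_quot => //; apply: ext0 => //; apply: ltnW.
- by apply: ext_le1_quot => //; apply: ext0.
Qed.

End LocalRing.

(** * Torsionless modules with one-dimensional socles *)

Section Embedding.
Variable R : comNzRingType.
Hypothesis noethR : noetherian R.
Variable W : lmodType R.

Lemma torsionless_separates (z : W) : torsionless W ->
  (forall phi : dualmod W, apply_hom phi z = 0) -> z = 0.
Proof.
move=> tl z0; apply: tl; apply: hom_ext => phi.
by rewrite -[LHS]/(apply_hom phi z) z0 -[RHS]/(apply_hom phi 0) /apply_hom linear0.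
Qed.

(** For a prime [annih y]: the form [phi] kills [y] after localization there. *)
Definition bad_at (y : W) (phi : dualmod W) : Prop :=
  exists2 a : R, ~ annih y a & a *: apply_hom phi y = 0.

(** Since [R] is noetherian, finitely many values [phi y] generate all of them;
    were each killed outside the prime [annih y], a product of the killing
    elements would kill [y] itself. *)
Lemma torsionless_good (y : W) : torsionless W -> isprime (annih y) ->
  exists phi, ~ bad_at y phi.
Proof.
move=> tl Py; apply: contrapT => /forallNP allbad.
have HT : issub (fun b : R^o => exists phi : dualmod W, apply_hom phi y = b).
  split=> [|_ _ [f <-] [g <-]|a _ [f <-]]; first by exists 0.
    by exists (f + g).
  by exists (a *: f).
have [t [tT Tt]] := ideal_fg noethR HT.
have [b bt|b bt|c cP yc] := prime_outside (p := fun b : R^o => annih b) (s := t) _ Py.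
- exact: annih_sub.
- have [phi <-] := tT b bt; have /contrapT[a ya a0] := allbad phi.
  by exists a.
apply: yc; apply: (torsionless_separates tl) => phi.
rewrite /apply_hom linearZ /=.
apply: (spn_le (S := fun b : R^o => c *: b = 0) _ cP (Tt _ _)); last by exists phi.
split=> [|u v cu cv|a u cu]; first by rewrite scaler0.
  by rewrite scalerDr cu cv addr0.
by rewrite scalerA mulrC -scalerA cu scaler0.
Qed.

(** Module avoidance gives a [phi] that is not bad at any element of a list
    representing the associated primes. A nonzero kernel would contain an
    element with annihilator one of these primes; by the bound on socles it has a
    nonzero multiple in common with the listed element, which [phi] would kill. *)
Lemma torsionless_embeds : fin_gen W -> torsionless W ->
  (forall p, isprime p -> socle_le1 p (fun z : W => z = 0)) ->
  exists phi : {linear W -> R^o}, injective phi.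
Proof.
move=> fgW tl soc.
have [s [sP sAss]] := finite_assoc noethR fgW.
have [||||y /sP Py|phi phiP] := module_avoidance (V := dualmod W) (s := s)
    (p := @annih _ _) (bad := bad_at) sP.
- move=> y /sP Py; split=> [|f g [a ya af] [b yb bg]|c f [a ya af]].
  + by exists 1; [exact: prime1 Py|rewrite scale1r].
  + exists (a * b); first exact: primeMn.
    rewrite -[apply_hom _ _]/(apply_hom f y + apply_hom g y) scalerDr.
    by rewrite {1}mulrC -!scalerA af bg !scaler0 addr0.
  + exists a => //; rewrite -[apply_hom _ _]/(c *: apply_hom f y).
    by rewrite scalerA mulrC -scalerA af scaler0.
- move=> y c f /sP Py yc; exists 1; first exact: prime1 Py.
  rewrite scale1r -[apply_hom _ _]/(c *: apply_hom f y) /apply_hom -linearZ.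
  by rewrite (yc : c *: y = 0) linear0.
- move=> y c f /sP Py yc [a ya acf]; exists (a * c); first exact: primeMn.
  by rewrite -scalerA.
- move=> y y' /sP Py _ yy' y'y f [a ya af].
  have [b yb|b yb|r1 [r2 [r0 nr]]] := soc _ Py y y'; [exact: yb|exact: yy'|].
  have nr1 : ~ annih y r1.
    move=> yr1; apply: nr; split=> //; apply: y'y.
    by move: r0; rewrite (yr1 : r1 *: y = 0) add0r.
  have nr2 : ~ annih y r2.
    move=> yr2; apply: nr; split=> //.
    by move: r0; rewrite (yy' _ yr2 : r2 *: y' = 0) addr0.
  exists (a * r2); first by move/y'y; apply: primeMn.
  have -> : (a * r2) *: apply_hom f y' = - (r1 *: (a *: apply_hom f y)).
    apply/eqP; rewrite -addr_eq0 !scalerA [r1 * a]mulrC -!scalerA -scalerDr.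
    by rewrite /apply_hom -!linearZ -linearD /= addrC r0 linear0 scaler0.
  by rewrite af scaler0 oppr0.
- exact: torsionless_good.
exists phi => u v uv; apply/eqP; rewrite -subr_eq0; apply/eqP.
have : apply_hom phi (u - v) = 0 by rewrite /apply_hom linearB uv subrr.
move: (u - v) => z phiz; apply: contrapT => nz.
have [r Pr] := assoc_prime noethR (zero_sub W) nz.
have [y ys yz] := sAss _ Pr.
have [b //|b /yz //|r1 [r2 [r0 nr]]] := soc _ Pr (r *: z) y.
have zr2 : annih (r *: z) r2.
  apply/yz; apply: contrapT => nr2; apply: (phiP y ys); exists r2 => //.
  move: (congr1 (apply_hom phi) r0).
  by rewrite /apply_hom linearD !linearZ /= [_ z]phiz !scaler0 add0r linear0.
apply: nr; split=> //.
by move: r0; rewrite ((yz _).1 zr2 : r2 *: y = 0) addr0.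
Qed.

Lemma embeds_ideal (phi : {linear W -> R^o}) : injective phi ->
  exists I : ideal R, lmod_iso W (submod I).
Proof.
move=> inj; exists (mim phi : submodClosed R^o).
have im x : phi x \in mim phi by apply/asboolP; exists x.
pose h x : submod (mim phi) := Submod (im x).
have hlin : linear h.
  by move=> a x y; apply: val_inj; rewrite /= linearP.
exists (HB.pack_for {linear W -> submod (mim phi)} h
  (GRing.isLinear.Build R W (submod (mim phi)) _ h hlin)).
have surj (y : submod (mim phi)) : exists x, phi x = val y.
  by case: y => y yI; have /asboolP[x xy] := yI; exists x.
have [g gP] := choice surj; exists g => [x|y].
  by apply: inj; rewrite gP.
by apply: val_inj; rewrite /= gP.
Qed.

Lemma ideal_torsionless (I : ideal R) : lmod_iso W (submod I) -> torsionless W.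
Proof.
case=> f /bij_inj finj x y xy.
pose phi : dualmod W := (\val : submod I -> R^o) \o f.
have := congr1 (fun h : dualmod (dualmod W) => apply_hom h phi) xy.
by move=> /val_inj /finj.
Qed.

End Embedding.

Theorem proposition3p2 (R : comNzRingType) (m : ideal R) (omega : lmodType R) :
  noetherian R -> is_local_ring m -> cohen_macaulay m ->
  canonical_module m omega ->
  (torsionless omega <-> exists I : ideal R, lmod_iso omega (submod I)).
Proof.
move=> noethR locR _ [fgW [d [hd ext0 ext1]]]; split; last first.
  by case=> I; apply: ideal_torsionless.
move=> tl; have [p Pp|phi /embeds_ideal//] := torsionless_embeds noethR fgW tl.
apply: (ext_socle_le1 noethR locR fgW Pp (krull_coht_le hd Pp)) => [i id f|f1 f2].
  by apply: Ext_trivial_coboundary; apply: ext0 => E; rewrite E ltnn in id.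
exact: Ext_residue_coboundary (local_notin1 locR) ext1.
Qed.
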